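(* Let $n\ge 2$, let $\mathbf{q}=(\mathbf{q}_1,\dots,\mathbf{q}_n)$ be an $n$-body central configuration in $\mathbb{R}^3$ with masses $m_1,\dots,m_n$ and center of mass $c$, and let $\bar{\mathbf{q}}=(\mathbf{q}_0,\mathbf{q}_1,\dots,\mathbf{q}_n)$ be the configuration obtained by adding a mass $m_0$ at a position $\mathbf{q}_0$. There are only five ways in which $\bar{\mathbf{q}}$ can be a non-collinear $(n+1)$-body central configuration; that is, a non-collinear $\bar{\mathbf{q}}$ is central if and only if one of the following holds: I (co-circular to planar): $\mathbf{q}$ is co-circular, its center of mass coincides with its geometric center, and $\mathbf{q}_0$ is the geometric center; the extended configuration is planar. II (co-circular to planar): $\mathbf{q}$ is co-circular, its center of mass does not coincide with its geometric center, $r=r_0$, and $\mathbf{q}_0$ is the geometric center; the extended configuration is planar. III (co-circular to pyramidal): $\mathbf{q}$ is co-circular, its center of mass may or may not coincide with its geometric center, $r<r_0$, and $\mathbf{q}_0$ lies on the line through the center of the circle orthogonal to the plane of the circle, with $|\mathbf{q}_1-\mathbf{q}_0|=r_0$; the extended configuration is pyramidal. IV (co-spherical to spatial): $\mathbf{q}$ is co-spherical, its center of mass coincides with its geometric center, and $\mathbf{q}_0$ is the geometric center. V (co-spherical to spatial): $\mathbf{q}$ is co-spherical, its center of mass does not coincide with its geometric center, $r=r_0$, and $\mathbf{q}_0$ is the geometric center.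
   Context: All masses are positive, and the bodies of a configuration occupy pairwise distinct positions in $\mathbb{R}^3$. For bodies with masses $m_1,\dots,m_k$ at $\mathbf{q}_1,\dots,\mathbf{q}_k$ ($k\ge2$) put $m=\sum_i m_i$, $c=\frac1m\sum_i m_i\mathbf{q}_i$, $U=\sum_{i<j}\frac{m_im_j}{|\mathbf{q}_i-\mathbf{q}_j|}$, $I=\sum_i m_i|\mathbf{q}_i-c|^2$. The configuration is central if $\nabla U+\frac{\lambda}{2}\nabla I=0$ with $\lambda=U/I$, i.e. $\sum_{j\ne i} m_im_j\frac{\mathbf{q}_j-\mathbf{q}_i}{|\mathbf{q}_j-\mathbf{q}_i|^3}=-\lambda m_i(\mathbf{q}_i-c)$ for all $i$. A configuration is collinear (planar) if all bodies lie on a line (in a plane), and spatial if it is not planar. A configuration is co-circular if its bodies lie on a common circle, and co-spherical if its bodies lie on a common sphere and it is not planar. The geometric center is the center of that circle (sphere), and $r$ denotes its radius. For $\mathbf{q}$, $r_0=(m/\lambda)^{1/3}=(mI/U)^{1/3}$, computed from the $n$ bodies $m_1,\dots,m_n$ only. A pyramidal central configuration is an $(n+1)$-body spatial central configuration of which $n$ points lie in an affine plane. Convention for $n=2$: the circle through the two bodies is not unique, and each condition on a co-circular $\mathbf{q}$ means that it holds for some circle containing both bodies; way III, whose outcome is a spatial configuration, does not occur for $n=2$. *)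

(* Defs.v *)
From mathcomp Require Import all_boot all_order all_algebra.
From mathcomp Require Import reals exp.

Set Implicit Arguments.
Unset Strict Implicit.
Unset Printing Implicit Defensive.

Import Order.TTheory GRing.Theory Num.Theory.
Local Open Scope ring_scope.

Section Geometry.
Variable R : realType.
Implicit Types (u v x o N : 'rV[R]_3) (r : R) (k : nat).

Definition dot u v : R := (u *m v^T) 0 0.

(* The norm `|u| that the library puts on matrices is the sup norm, hence a
   separate Euclidean norm. *)
Definition enorm u : R := Num.sqrt (dot u u).

Definition collinear k (q : 'I_k -> 'rV[R]_3) : Prop :=
  exists p u, u != 0 /\ forall i, exists t : R, q i = p + t *: u.

Definition planar k (q : 'I_k -> 'rV[R]_3) : Prop :=
  exists p N, N != 0 /\ forall i, dot (q i - p) N = 0.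

Definition spatial k (q : 'I_k -> 'rV[R]_3) : Prop := ~ planar q.

(* The circle with center o and radius r in the plane through o with normal
   vector N. *)
Definition on_circle o N r x : Prop := dot (x - o) N = 0 /\ enorm (x - o) = r.

Definition on_sphere o r x : Prop := enorm (x - o) = r.

Definition cocircular_on o N r k (q : 'I_k -> 'rV[R]_3) : Prop :=
  [/\ N != 0, 0 < r & forall i, on_circle o N r (q i)].

Definition cospherical_on o r k (q : 'I_k -> 'rV[R]_3) : Prop :=
  [/\ spatial q, 0 < r & forall i, on_sphere o r (q i)].

End Geometry.

Section CentralConfigurations.
Variable R : realType.
Variable k : nat.
Implicit Types (m : 'I_k -> R) (q : 'I_k -> 'rV[R]_3).

Definition total_mass m : R := \sum_i m i.

Definition center_of_mass m q : 'rV[R]_3 :=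
  (total_mass m)^-1 *: \sum_i m i *: q i.

Definition potential m q : R :=
  \sum_(i < k) \sum_(j < k | (i < j)%N) m i * m j / enorm (q i - q j).

Definition inertia m q : R :=
  \sum_i m i * enorm (q i - center_of_mass m q) ^+ 2.

Definition lambda m q : R := potential m q / inertia m q.

Definition configuration m q : Prop := (forall i, 0 < m i) /\ injective q.

Definition central_configuration m q : Prop :=
  configuration m q /\
  forall i : 'I_k,
    \sum_(j < k | j != i) (m i * m j / enorm (q j - q i) ^+ 3) *: (q j - q i)
    = - (lambda m q * m i) *: (q i - center_of_mass m q).

Definition r0 m q : R := (total_mass m / lambda m q) `^ 3^-1.

End CentralConfigurations.

(* The family x, f 0, ..., f (n - 1): the added body gets index 0 and the
   body i of the original configuration gets index i + 1. *)
Definition extend (T : Type) n (x : T) (f : 'I_n -> T) : 'I_n.+1 -> T :=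
  fun i => oapp f x (unlift ord0 i).

Definition pyramidal (R : realType) n (m : 'I_n.+1 -> R)
    (q : 'I_n.+1 -> 'rV[R]_3) : Prop :=
  [/\ central_configuration m q, spatial q &
      exists i : 'I_n.+1, planar (fun j : 'I_n => q (lift i j))].

(* The circle and the sphere are existentially quantified.  They are unique,
   except for the circle when n = 2, where any circle through the two bodies
   is allowed. *)
Section Ways.
Variables (R : realType) (n : nat).
Variables (m : 'I_n -> R) (q : 'I_n -> 'rV[R]_3) (q0 : 'rV[R]_3).

Definition wayI : Prop :=
  exists o N r, [/\ cocircular_on o N r q, center_of_mass m q = o & q0 = o].

Definition wayII : Prop :=
  exists o N r,
    [/\ cocircular_on o N r q, center_of_mass m q <> o, r = r0 m q & q0 = o].

(* Ordinal (ltnW hn) is the first body of q.  The condition 2 < n excludes the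
   two-body case, in which the extended configuration cannot be spatial. *)
Definition wayIII (hn : (1 < n)%N) : Prop :=
  (2 < n)%N /\
  exists o N r,
    [/\ cocircular_on o N r q, r < r0 m q,
        exists t : R, q0 = o + t *: N &
        enorm (q (Ordinal (ltnW hn)) - q0) = r0 m q].

Definition wayIV : Prop :=
  exists o r, [/\ cospherical_on o r q, center_of_mass m q = o & q0 = o].

Definition wayV : Prop :=
  exists o r,
    [/\ cospherical_on o r q, center_of_mass m q <> o, r = r0 m q & q0 = o].

End Ways.

(* Main.v *)
(* Let d_i = |q_i - q0|, M the mass and c the center of mass of q, and
   l = lambda(q).  Subtracting the equations for q from those for the extended
   configuration with multiplier mu leaves, for each old body,
     (mu - l - m0 / d_i^3) (q_i - q0) = (mu M / (M + m0) - l) (c - q0).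
   If the right-hand side were nonzero, all bodies would lie on the line
   through q0 and c.  So both sides vanish: all d_i equal a common d, and
   either c = q0 or mu = l (M + m0) / M, that is d = r0.  Conversely these
   conditions give the equations with mu = l + m0 / d^3, and Euler's identity
   forces the multiplier to be U / I.  The five ways list the positions of a
   point q0 equidistant from all bodies. *)
Require Import Defs.
From mathcomp Require Import all_boot all_order all_algebra.
From mathcomp Require Import reals.
From mathcomp Require Import boolp exp ring lra.

Set Implicit Arguments.
Unset Strict Implicit.
Unset Printing Implicit Defensive.

Import Order.TTheory GRing.Theory Num.Theory.
Local Open Scope ring_scope.

(** * Inner product geometry of three-space *)

Section EuclideanSpace.
Variable R : realType.
Implicit Types (u v w : 'rV[R]_3) (a : R).

Lemma dotE u v : dot u v = \sum_k u 0 k * v 0 k.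
Proof. by rewrite /dot mxE; apply: eq_bigr => k _; rewrite mxE. Qed.

Lemma dotC u v : dot u v = dot v u.
Proof. by rewrite !dotE; apply: eq_bigr => k _; rewrite mulrC. Qed.

Lemma dotDl u v w : dot (u + v) w = dot u w + dot v w.
Proof. by rewrite /dot mulmxDl mxE. Qed.

Lemma dotZl a u v : dot (a *: u) v = a * dot u v.
Proof. by rewrite /dot -scalemxAl mxE. Qed.

Lemma dotNl u v : dot (- u) v = - dot u v.
Proof. by rewrite -scaleN1r dotZl mulN1r. Qed.

Lemma dotBl u v w : dot (u - v) w = dot u w - dot v w.
Proof. by rewrite dotDl dotNl. Qed.

Lemma dotDr u v w : dot w (u + v) = dot w u + dot w v.
Proof. by rewrite dotC dotDl !(dotC w). Qed.

Lemma dotBr u v w : dot w (u - v) = dot w u - dot w v.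
Proof. by rewrite dotC dotBl !(dotC w). Qed.

Lemma dotZr a u v : dot u (a *: v) = a * dot u v.
Proof. by rewrite dotC dotZl dotC. Qed.

Lemma dot0l u : dot 0 u = 0.
Proof. by rewrite -(scale0r 0) dotZl mul0r. Qed.

Lemma dot_suml (I : Type) (s : seq I) (P : pred I) (F : I -> 'rV[R]_3) v :
  dot (\sum_(i <- s | P i) F i) v = \sum_(i <- s | P i) dot (F i) v.
Proof.
by elim/big_rec2: _ => [|i x y _ <-]; [rewrite dot0l | rewrite dotDl].
Qed.

Lemma dot_ge0 u : 0 <= dot u u.
Proof. by rewrite dotE sumr_ge0 // => k _; rewrite -expr2 sqr_ge0. Qed.

Lemma dot_eq0 u : (dot u u == 0) = (u == 0).
Proof.
apply/eqP/eqP => [|->]; last exact: dot0l.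
rewrite dotE => /psumr_eq0P h; apply/rowP => k; rewrite mxE.
have /eqP := h (fun i _ => sqr_ge0 (u 0 i)) k isT.
by rewrite mulf_eq0 orbb => /eqP.
Qed.

Lemma enorm_ge0 u : 0 <= enorm u.
Proof. exact: sqrtr_ge0. Qed.

Lemma sqr_enorm u : enorm u ^+ 2 = dot u u.
Proof. by rewrite sqr_sqrtr // dot_ge0. Qed.

Lemma enorm_gt0 u : (0 < enorm u) = (u != 0).
Proof. by rewrite sqrtr_gt0 lt0r dot_ge0 dot_eq0 andbT. Qed.

Lemma enormB u v : enorm (u - v) = enorm (v - u).
Proof. by rewrite /enorm -opprB dotNl dotC dotNl opprK. Qed.

(** A line meets a sphere in at most two points: putting [w = u + a (v - u)] into [|w|^2 = |u|^2]
    gives [a (a - 1) |v - u|^2 = 0], hence [w = u] or [w = v]. *)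
Lemma sphere_not_collinear u v w :
  dot u u = dot v v -> dot u u = dot w w -> v != u -> w != u -> w != v ->
  ~ exists a, w - u = a *: (v - u).
Proof.
move=> euv euw vu wu wv [a e].
have ew : w = u + a *: (v - u) by rewrite -e addrC subrK.
have d0 : dot (v - u) (v - u) != 0 by rewrite dot_eq0 subr_eq0.
have aP : a * (a - 1) * dot (v - u) (v - u) = 0.
  move: euw; rewrite ew !(dotBl, dotBr, dotDl, dotDr, dotZl, dotZr) (dotC v u).
  rewrite -euv; move: (dot u u) (dot u v) => x y euw.
  by apply/eqP; rewrite -subr_eq0; apply/eqP; move: euw; lra.
move/eqP: aP; rewrite !mulf_eq0 (negbTE d0) orbF subr_eq0 => /orP[] /eqP a01.
  by move: wu; rewrite ew a01 scale0r addr0 eqxx.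
by move: wv; rewrite ew a01 scale1r addrC subrK eqxx.
Qed.

(* The two normals span a plane, so their orthogonal complement is a line. *)
Lemma common_orthogonal_parallel (N N' u v : 'rV[R]_3) :
  N != 0 -> (forall a, N' <> a *: N) -> u != 0 ->
  dot u N = 0 -> dot u N' = 0 -> dot v N = 0 -> dot v N' = 0 ->
  exists a, v = a *: u.
Proof.
move=> N0 NN' u0 uN uN' vN vN'.
pose K := kermx (col_mx N N')^T.
have inK w : dot w N = 0 -> dot w N' = 0 -> (w <= K)%MS.
  move=> wN wN'; apply/sub_kermxP; rewrite tr_col_mx mul_mx_row.
  apply/eqP; rewrite row_mx_eq0; apply/andP; split; apply/eqP/matrixP => i j;
    by rewrite !ord1 [RHS]mxE.
have rkN : (1 < \rank (col_mx N N'))%N.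
  have /rank_ltmx : (N < col_mx N N')%MS.
    rewrite ltmxE -{1}addsmxE addsmxSl /= col_mx_sub submx_refl /=.
    by apply/sub_rVP => -[a]; apply: NN'.
  by rewrite rank_rV N0.
have rkK : (\rank K <= 1)%N by rewrite mxrank_ker mxrank_tr leq_subLR addn1.
have Ku : (K <= u)%MS.
  rewrite -(geq_leqif (mxrank_leqif_sup (inK u uN uN'))).
  by rewrite rank_rV u0.
by apply/sub_rVP; apply: submx_trans Ku; apply: inK.
Qed.

Lemma exists_orthogonal u v :
  exists N, [/\ N != 0, dot u N = 0 & dot v N = 0].
Proof.
have /rowV0Pn[N /sub_kermxP NK N0] : kermx (col_mx u v)^T != 0.
  rewrite -mxrank_eq0 mxrank_ker mxrank_tr -lt0n subn_gt0.
  by rewrite (leq_ltn_trans (rank_leq_row _)).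
exists N; move: NK; rewrite tr_col_mx mul_mx_row => /eqP.
rewrite row_mx_eq0 => /andP[/eqP e1 /eqP e2].
by rewrite dotC (dotC v) /dot e1 e2 !mxE.
Qed.

End EuclideanSpace.

(** * Central equations, Euler's identity and positivity of U, I and r0 *)

Section CentralEquations.
Variables (R : realType) (k : nat).
Implicit Types (m : 'I_k -> R) (q : 'I_k -> 'rV[R]_3) (mu : R).

(** The multiplier is left free, so that one can be proposed for the extended configuration and
    identified with [U / I] afterwards. *)
Definition central_equation m q mu (i : 'I_k) : Prop :=
  \sum_(j < k | j != i) (m i * m j / enorm (q j - q i) ^+ 3) *: (q j - q i)
  = - (mu * m i) *: (q i - center_of_mass m q).

Lemma sum_pairs (F : 'I_k -> 'I_k -> R) :
  \sum_(i < k) \sum_(j < k | j != i) F i j =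
  \sum_(i < k) \sum_(j < k | (i < j)%N) (F i j + F j i).
Proof.
have -> : \sum_(i < k) \sum_(j < k | j != i) F i j =
    \sum_(i < k) \sum_(j < k | (i < j)%N) F i j +
    \sum_(i < k) \sum_(j < k | (j < i)%N) F i j.
  rewrite -big_split /=; apply: eq_bigr => i _.
  rewrite (bigID (fun j : 'I_k => (i < j)%N)) /=; congr (_ + _);
    apply: eq_bigl => j; rewrite -(inj_eq val_inj) /=; by case: ltngtP.
rewrite [X in _ + X](exchange_big_dep predT) //= -big_split /=.
by apply: eq_bigr => i _; rewrite -big_split.
Qed.

(* Pair the equations with [q i - c] and sum: this is Euler's identity for
   the homogeneous function U of degree -1. *)
Lemma central_potential m q mu :
  injective q -> (forall i, central_equation m q mu i) ->
  potential m q = mu * inertia m q.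
Proof.
move=> injq h; apply: oppr_inj; set c := center_of_mass m q.
have -> : - (mu * inertia m q) = \sum_i \sum_(j < k | j != i)
    (m i * m j / enorm (q j - q i) ^+ 3) * dot (q j - q i) (q i - c).
  rewrite /inertia mulr_sumr -sumrN; apply: eq_bigr => i _.
  transitivity (dot (- (mu * m i) *: (q i - c)) (q i - c)).
    by rewrite dotZl sqr_enorm; ring.
  rewrite -h dot_suml; apply: eq_bigr => j _; by rewrite dotZl.
rewrite sum_pairs /potential -sumrN; apply: eq_bigr => i _.
rewrite -sumrN; apply: eq_bigr => j ij.
have d0 : enorm (q i - q j) != 0.
  rewrite gt_eqF // enorm_gt0 subr_eq0 (inj_eq injq).
  by apply: contraTneq ij => ->; rewrite ltnn.
have := sqr_enorm (q i - q j).
rewrite (enormB (q j)) !(dotBl, dotBr) (dotC (q j) (q i)).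
move: (enorm _) d0 => d d0 e.
(* Multiplying by [d ^+ 2 / d ^+ 2] and expanding only the numerator into inner products matches the
   two ordered terms of the pair. *)
rewrite -[LHS]mulr1 -(mulfV (expf_neq0 2 d0)) {1}e.
by field.
Qed.

Lemma total_mass_gt0 m : (0 < k)%N -> (forall i, 0 < m i) -> 0 < total_mass m.
Proof.
move=> k0 m0; rewrite /total_mass (bigD1 (Ordinal k0)) //=.
by rewrite ltr_wpDr // sumr_ge0 // => i _; exact: ltW.
Qed.

Lemma inertia_gt0 m q : (1 < k)%N -> configuration m q -> 0 < inertia m q.
Proof.
move=> k1 [mpos injq]; set c := center_of_mass m q.
have ge0 i : 0 <= m i * enorm (q i - c) ^+ 2.
  by rewrite mulr_ge0 ?exprn_ge0 ?enorm_ge0 // ltW.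
rewrite lt0r sumr_ge0 ?andbT //; apply/eqP => /psumr_eq0P h.
have qc i : q i = c.
  have /eqP := h (fun i _ => ge0 i) i isT.
  rewrite mulf_eq0 gt_eqF //= sqr_enorm dot_eq0 subr_eq0.
  by move/eqP.
by have := injq (Ordinal k1) (Ordinal (ltnW k1)); rewrite !qc => /(_ erefl) [].
Qed.

Lemma potential_gt0 m q : (1 < k)%N -> configuration m q -> 0 < potential m q.
Proof.
move=> k1 [mpos injq].
have gt0 (i j : 'I_k) : (i < j)%N -> 0 < m i * m j / enorm (q i - q j).
  move=> ij; rewrite divr_gt0 ?mulr_gt0 // enorm_gt0 subr_eq0 (inj_eq injq).
  by apply: contraTneq ij => ->; rewrite ltnn.
rewrite /potential (bigD1 (Ordinal (ltnW k1))) //=.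
rewrite (bigD1 (Ordinal k1)) //= -addrA.
rewrite ltr_wpDr ?gt0 // addr_ge0 ?sumr_ge0 // => [j /andP[ij _]|i _].
  exact/ltW/gt0.
by apply: sumr_ge0 => j /gt0/ltW.
Qed.

Lemma lambda_gt0 m q : (1 < k)%N -> configuration m q -> 0 < lambda m q.
Proof. by move=> *; rewrite divr_gt0 ?potential_gt0 ?inertia_gt0. Qed.

(** Euler's identity gives [U = mu I], and [I > 0], so any common multiplier is [lambda]. *)
Lemma central_configuration_mult m q mu : (1 < k)%N -> configuration m q ->
  (forall i, central_equation m q mu i) -> central_configuration m q.
Proof.
move=> k1 conf h; split=> //; suff -> : lambda m q = mu by [].
rewrite /lambda (central_potential conf.2 h) mulfK //.
by rewrite gt_eqF ?inertia_gt0.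
Qed.

Lemma r0_gt0 m q : (1 < k)%N -> configuration m q -> 0 < r0 m q.
Proof.
move=> k1 conf; rewrite powR_gt0 // divr_gt0 ?lambda_gt0 //.
by rewrite total_mass_gt0 ?(ltnW k1) //; case: conf.
Qed.

Lemma r0_cube m q : (1 < k)%N -> configuration m q ->
  r0 m q ^+ 3 = total_mass m / lambda m q.
Proof.
move=> k1 conf.
have M0 := total_mass_gt0 (ltnW k1) conf.1.
have L0 := lambda_gt0 k1 conf.
rewrite -powR_mulrn ?powR_ge0 // -powRrM mulVf ?pnatr_eq0 //.
by rewrite powRr1 // divr_ge0 // ltW.
Qed.

Lemma sum_mass_position m q : 0 < total_mass m ->
  \sum_i m i *: q i = total_mass m *: center_of_mass m q.
Proof. by move=> M0; rewrite scalerA mulfV ?scale1r ?gt_eqF. Qed.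

Lemma center_of_mass_planar m q p N : 0 < total_mass m ->
  (forall i, dot (q i - p) N = 0) -> dot (center_of_mass m q - p) N = 0.
Proof.
move=> M0 h; rewrite dotBl dotZl dot_suml.
rewrite (eq_bigr (fun i => m i * dot p N)) => [|i _].
  by rewrite -mulr_suml mulrA mulVf ?mul1r ?subrr ?gt_eqF.
by rewrite dotZl; move/eqP: (h i); rewrite dotBl subr_eq0 => /eqP ->.
Qed.

End CentralEquations.

(** * Adding one body: centrality and equidistance *)

Section Extension.

Lemma extend0 (T : Type) n (x : T) (f : 'I_n -> T) : extend x f ord0 = x.
Proof. by rewrite /extend unlift_none. Qed.

Lemma extendS (T : Type) n (x : T) (f : 'I_n -> T) i :
  extend x f (lift ord0 i) = f i.
Proof. by rewrite /extend liftK. Qed.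

Lemma forall_ord_extend n (P : 'I_n.+1 -> Prop) :
  P ord0 -> (forall i : 'I_n, P (lift ord0 i)) -> forall i, P i.
Proof. by move=> P0 PS i; case: (unliftP ord0 i) => [j|] ->. Qed.

Variables (R : realType) (n : nat).
Hypothesis hn : (1 < n)%N.
Variables (m : 'I_n -> R) (q : 'I_n -> 'rV[R]_3) (m0 : R) (q0 : 'rV[R]_3).
Hypothesis hq : central_configuration m q.
Hypothesis hext : configuration (extend m0 m) (extend q0 q).

Let M := total_mass m.
Let c := center_of_mass m q.

Let m_gt0 i : 0 < m i. Proof. by case: hq => -[]. Qed.
Let M_gt0 : 0 < M. Proof. exact: total_mass_gt0 (ltnW hn) m_gt0. Qed.
Let m0_gt0 : 0 < m0. Proof. by have := hext.1 ord0; rewrite extend0. Qed.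
Let lambda0 : 0 < lambda m q. Proof. exact: lambda_gt0 hn hq.1. Qed.

Let q_neq_q0 i : q i - q0 != 0.
Proof.
have := inj_eq hext.2 (lift ord0 i) ord0; rewrite extend0 extendS subr_eq0.
by move=> ->.
Qed.

Lemma total_mass_extend : total_mass (extend m0 m) = m0 + M.
Proof.
rewrite /total_mass big_ord_recl extend0; congr (_ + _).
by apply: eq_bigr => i _; rewrite extendS.
Qed.

Lemma center_of_mass_extend :
  center_of_mass (extend m0 m) (extend q0 q) =
  (m0 + M)^-1 *: (m0 *: q0 + M *: c).
Proof.
rewrite /center_of_mass total_mass_extend big_ord_recl !extend0.
rewrite -(sum_mass_position q M_gt0); congr (_ *: (_ + _)).
by apply: eq_bigr => i _; rewrite !extendS.
Qed.

Lemma central_equation_extendS mu i :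
  central_equation (extend m0 m) (extend q0 q) mu (lift ord0 i) <->
  (mu - lambda m q - m0 / enorm (q i - q0) ^+ 3) *: (q i - q0) =
  (mu * M / (m0 + M) - lambda m q) *: (c - q0).
Proof.
rewrite /central_equation center_of_mass_extend big_mkcond big_ord_recl /=.
rewrite (eq_bigr (fun j => if j != i then
    (m i * m j / enorm (q j - q i) ^+ 3) *: (q j - q i) else 0)); last first.
  by move=> j _; rewrite (inj_eq (@lift_inj _ _)) !extendS.
rewrite -big_mkcond /= hq.2 !extendS !extend0 (enormB q0) -/c.
have mi := lt0r_neq0 (m_gt0 i).
have mM : m0 + M != 0 by rewrite gt_eqF ?addr_gt0.
set l := lambda m q; set d := (enorm _ ^+ 3)^-1.
set LHS := (X in X = _ <-> _); set RHS := (X in _ = X <-> _).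
set L := (X in _ <-> X = _); set L' := (X in _ <-> _ = X).
(* The equation of [q] has replaced the sum over the old bodies. What remains is [m i] times the
   reduced equation, and [m i] is nonzero. *)
have E : LHS - RHS = m i *: (L - L').
  rewrite /LHS /RHS /L /L'; clearbody c M l d.
  by apply/rowP => j; rewrite !mxE; field.
split=> [e|e].
  apply/eqP; have /eqP := E; rewrite e subrr eq_sym scaler_eq0 (negbTE mi).
  by rewrite subr_eq0.
by apply/eqP; rewrite -subr_eq0 E e subrr scaler0.
Qed.

(** A middle term between centrality and the five ways, mentioning neither circles nor spheres. *)
Definition equidistant : Prop :=
  exists d, (forall i, enorm (q i - q0) = d) /\ (c = q0 \/ d = r0 m q).

Lemma central_extend_equidistant : ~ collinear (extend q0 q) ->
  central_configuration (extend m0 m) (extend q0 q) -> equidistant.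
Proof.
move=> ncol [_ h].
set mu := lambda (extend m0 m) (extend q0 q) in h.
have {}h i := (central_equation_extendS mu i).1 (h (lift ord0 i)).
set A := mu * M / (m0 + M) - lambda m q in h.
have mM : m0 + M != 0 by rewrite gt_eqF ?addr_gt0.
have Ac : A *: (c - q0) = 0.
  apply/eqP; apply: contra_notT ncol => Ac.
  exists q0, (c - q0); split.
    by apply: contraNneq Ac => ->; rewrite scaler0.
  apply: forall_ord_extend => [|i].
    by exists 0; rewrite extend0 scale0r addr0.
  move: (h i); set a := (X in X *: _ = _) => hi.
  (* Solves [a (q i - q0) = A (c - q0)] for [q i]; [a] is nonzero because the right-hand side is. *)
  exists (a^-1 * A); rewrite extendS -scalerA -hi scalerA mulVf ?scale1r.
    by rewrite addrC subrK.
  by apply: contraNneq Ac => a0; rewrite -hi a0 scale0r.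
have hd i : m0 / enorm (q i - q0) ^+ 3 = mu - lambda m q.
  move/eqP: (h i); rewrite Ac scaler_eq0 (negbTE (q_neq_q0 i)) orbF subr_eq0.
  by move/eqP.
have hcube i : enorm (q i - q0) ^+ 3 = m0 / (mu - lambda m q).
  by rewrite -(hd i) invf_div mulrC divfK // gt_eqF.
pose i0 := Ordinal (ltnW hn).
exists (enorm (q i0 - q0)); split=> [i|].
  by apply/eqP; rewrite -(@eqrXn2 _ 3) ?enorm_ge0 // !hcube.
move/eqP: Ac; rewrite scaler_eq0 => /orP[/eqP A0|]; last first.
  by rewrite subr_eq0 => /eqP; left.
right; apply/eqP; rewrite -(@eqrXn2 _ 3) ?enorm_ge0 //; last first.
  exact/ltW/r0_gt0/hq.1.
rewrite hcube r0_cube //; last exact: hq.1.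
(* With this [mu], [mu - lambda = lambda m0 / M], so [d ^+ 3 = m0 / (mu - lambda) = M / lambda], the
   cube of [r0]. *)
have {A0} muE : mu = lambda m q * (m0 + M) / M.
  move/eqP: A0; rewrite subr_eq0 => /eqP <-; field.
  by rewrite mM gt_eqF.
rewrite muE -/M; apply/eqP; field.
have l0 := lt0r_neq0 lambda0; rewrite l0 (lt0r_neq0 M_gt0) /=.
have -> : lambda m q * (m0 + M) + - lambda m q * M = lambda m q * m0 by ring.
by rewrite mulf_neq0 ?lt0r_neq0.
Qed.

Lemma equidistant_central_extend : equidistant ->
  central_configuration (extend m0 m) (extend q0 q).
Proof.
case=> d [hd hc].
have d_gt0 : 0 < d.
  by rewrite -(hd (Ordinal (ltnW hn))) enorm_gt0.
have mM : m0 + M != 0 by rewrite gt_eqF ?addr_gt0.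
have M0 : M != 0 by rewrite gt_eqF.
have d0 : d != 0 by rewrite gt_eqF.
(* The value that cancels the coefficient of [q i - q0] in the reduced equation. *)
pose mu := lambda m q + m0 / d ^+ 3.
(* Trivial if [c = q0]. If [d = r0], then [M / d ^+ 3 = lambda] and [mu = lambda (m0 + M) / M], so
   both coefficients equal [lambda]. *)
have key : (mu * M / (m0 + M)) *: (c - q0) = (M / d ^+ 3) *: (c - q0).
  case: hc => [->|dr]; first by rewrite subrr !scaler0.
  congr (_ *: _); have : d ^+ 3 = M / lambda m q.
    by rewrite dr r0_cube //; exact: hq.1.
  move/(congr1 GRing.inv); rewrite invf_div => e.
  by rewrite /mu e; field; rewrite M0.
apply: (central_configuration_mult (mu := mu) (leqW hn) hext).
apply: forall_ord_extend => [|i].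
  (* All distances to the added body are [d], so the forces on it add up to
     [(m0 M / d ^+ 3) (c - q0)]; its equation is [m0] times [key]. *)
  rewrite /central_equation center_of_mass_extend big_mkcond big_ord_recl /=.
  rewrite add0r.
  rewrite (eq_bigr (fun i => (m0 / d ^+ 3) *: (m i *: q i - m i *: q0))).
    rewrite -scaler_sumr sumrB -scaler_suml (sum_mass_position q M_gt0) -/M -/c.
    rewrite !extend0 -scalerBr scalerA.
    transitivity (m0 *: ((M / d ^+ 3) *: (c - q0))).
      by rewrite scalerA; congr (_ *: _); ring.
    rewrite -key; clearbody c M mu; apply/rowP => j; rewrite !mxE; by field.
  move=> i _; rewrite !extend0 !extendS hd -scalerBr scalerA; congr (_ *: _).
  by ring.
apply/central_equation_extendS; rewrite hd /mu.
have -> : lambda m q + m0 / d ^+ 3 - lambda m q - m0 / d ^+ 3 = 0 by ring.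
rewrite scale0r scalerBl key -scalerBl.
case: hc => [->|dr]; first by rewrite subrr scaler0.
rewrite dr r0_cube //; last exact: hq.1.
by rewrite invf_div -/M mulrC divfK // subrr scale0r.
Qed.

(** * Planarity, and the five ways as positions of an equidistant point *)

Lemma planar_extendS : planar (extend q0 q) -> planar q.
Proof.
case=> p [N [N0 h]]; exists p, N; split=> // i.
by rewrite -(h (lift ord0 i)) extendS.
Qed.

Lemma planar_extend_center o N r :
  cocircular_on o N r q -> q0 = o -> planar (extend q0 q).
Proof.
case=> N0 _ h ->; exists o, N; split=> //.
apply: forall_ord_extend => [|i]; first by rewrite extend0 subrr dot0l.
by rewrite extendS; case: (h i).
Qed.

(** Three points always lie in a plane; this supplies the condition [2 < n] of way III. *)
Lemma spatial_extend_ge3 : ~ planar (extend q0 q) -> (2 < n)%N.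
Proof.
rewrite ltnNge => h; apply/negP => n2; apply: h.
have [N [N0 N1 N2]] := exists_orthogonal (q (Ordinal (ltnW hn)) - q0)
  (q (Ordinal hn) - q0).
exists q0, N; split=> //; apply: forall_ord_extend => [|i].
  by rewrite extend0 subrr dot0l.
rewrite extendS; have : (i < 2)%N by apply: leq_trans n2.
case: i => -[|[|//]] p _; [rewrite -N1 | rewrite -N2];
  by congr (dot (q _ - _) _); apply: val_inj.
Qed.

Lemma equidistant_of_way :
  wayI m q q0 \/ wayII m q q0 \/ wayIII m q q0 hn \/
  wayIV m q q0 \/ wayV m q q0 -> equidistant.
Proof.
case=> [|[|[|[|]]]].
- move=> [o [N [r [[_ _ h] co qo]]]]; exists r; split; last by left; rewrite qo.
  by move=> i; rewrite qo; case: (h i).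
- move=> [o [N [r [[_ _ h] _ rr qo]]]]; exists r; split; last by right.
  by move=> i; rewrite qo; case: (h i).
- move=> [_ [o [N [r [[_ _ h] _ [t qo] d1]]]]].
  exists (r0 m q); split; last by right.
  (* Pythagoras: the distance to a point of the axis is the same for all bodies, so the first body
     determines it. *)
  have sq i : dot (q i - q0) (q i - q0) = r ^+ 2 + t ^+ 2 * dot N N.
    have [h1 <-] := h i; rewrite sqr_enorm qo opprD addrA.
    move: (q i - o) h1 => y h1.
    by rewrite dotBl !dotBr !dotZl !dotZr (dotC N) h1; ring.
  by move=> i; rewrite -d1 /enorm !sq.
- move=> [o [r [[_ _ h] co qo]]]; exists r; split; last by left; rewrite qo.
  by move=> i; rewrite qo; apply: h.
- move=> [o [r [[_ _ h] _ rr qo]]]; exists r; split; last by right.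
  by move=> i; rewrite qo; apply: h.
Qed.

(** If the extension is planar, its plane cuts the sphere about [q0] in a circle centered at [q0]
    (I, II). If only [q] is planar, the circle is centered at the foot of the perpendicular from
    [q0] (III). Otherwise the sphere itself serves (IV, V). *)
Lemma way_of_equidistant : equidistant ->
  wayI m q q0 \/ wayII m q q0 \/ wayIII m q q0 hn \/
  wayIV m q q0 \/ wayV m q q0.
Proof.
case=> d [hd hc].
have d_gt0 : 0 < d by rewrite -(hd (Ordinal hn)) enorm_gt0.
have [[p [N [N0 hN]]]|nplan] := pselect (planar (extend q0 q)).
  have circ : cocircular_on q0 N d q.
    split=> // i; split; last exact: hd.
    have := hN (lift ord0 i); have := hN ord0; rewrite extend0 extendS.
    by rewrite !dotBl => /eqP; rewrite subr_eq0 => /eqP ->.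
  have [cq|cq] := eqVneq c q0; first by left; exists q0, N, d.
  right; left; exists q0, N, d; split=> //; first exact/eqP.
  by case: hc => // /eqP; rewrite (negbTE cq).
do 2!right.
have [[p [N [N0 hN]]]|sq] := pselect (planar q).
  left; split; first exact: spatial_extend_ge3.
  have NN : dot N N != 0 by rewrite dot_eq0.
  (* [o] is the orthogonal projection of [q0] onto the plane of [q]. *)
  pose t := dot (q0 - p) N / dot N N; pose o := q0 - t *: N.
  have t0 : t != 0.
    apply: contra_notN nplan => /eqP t0; exists p, N; split=> //.
    apply: forall_ord_extend => [|i]; rewrite ?extend0 ?extendS //.
    by move/eqP: t0; rewrite mulf_eq0 invr_eq0 (negbTE NN) orbF => /eqP.
  have oN i : dot (q i - o) N = 0.
    by have := hN i; rewrite /o /t !dotBl dotZl divfK // => h; lra.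
  (* The center of mass lies in the plane of [q] and [q0] does not, which leaves only [d = r0]. *)
  have cq : c <> q0.
    move=> cq; have := center_of_mass_planar M_gt0 hN; rewrite -/c cq => h.
    by move: t0; rewrite /t h mul0r eqxx.
  have dr : d = r0 m q by case: hc.
  (* Pythagoras again: this gives both a common radius about [o] and, since [t] is nonzero,
     [r < d = r0]. *)
  have sq i : dot (q i - o) (q i - o) = d ^+ 2 - t ^+ 2 * dot N N.
    rewrite -(hd i) sqr_enorm.
    have -> : q i - q0 = (q i - o) - t *: N.
      by rewrite /o opprB addrA addrAC addrK.
    move: (q i - o) (oN i) => y yN.
    by rewrite [in RHS]dotBl !dotBr !dotZl !dotZr (dotC N) yN; ring.
  pose r := enorm (q (Ordinal hn) - o).
  have hr i : enorm (q i - o) = r by rewrite /r /enorm !sq.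
  have r_gt0 : 0 < r.
    rewrite lt0r enorm_ge0 andbT; apply/eqP => r0.
    have qo i : q i = o.
      by apply/eqP; rewrite -subr_eq0 -dot_eq0 -sqr_enorm hr r0 expr0n.
    have := hq.1.2 (Ordinal hn) (Ordinal (ltnW hn)).
    by rewrite !qo => /(_ erefl) [].
  exists o, N, r; split.
  - by split=> // i; split.
  - rewrite -dr -(@ltr_pXn2r _ 2) ?nnegrE ?enorm_ge0 ?ltW //.
    rewrite /r sqr_enorm sq ltrBlDr ltrDl mulr_gt0 //.
      by rewrite exprn_even_gt0 // t0.
    by rewrite lt0r NN dot_ge0.
  - by exists t; rewrite /o subrK.
  - by rewrite hd.
right; have sph : cospherical_on q0 d q by split.
have [cq|cq] := eqVneq c q0; first by left; exists q0, d.
right; exists q0, d; split=> //; first exact/eqP.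
by case: hc => // /eqP; rewrite (negbTE cq).
Qed.

(* If [extend q0 q] had a plane with normal N', then N' is not parallel to N
   since q0 is off the plane of the circle, and the circle would meet the line
   common to both planes in three points. *)
Lemma wayIII_spatial : wayIII m q q0 hn -> spatial (extend q0 q).
Proof.
case=> n3 [o [N [r [[N0 r_gt0 h] rlt [t qo] d1]]]] [p [N' [N'0 hN']]].
have t0 : t != 0.
  apply: contraTneq rlt => t0; rewrite -d1 qo t0 scale0r addr0.
  by rewrite (h _).2 ltxx.
have NN : dot N N != 0 by rewrite dot_eq0.
have qN' i j : dot (q i - q j) N' = 0.
  have := hN' (lift ord0 i); have := hN' (lift ord0 j); rewrite !extendS.
  rewrite !dotBl => /eqP; rewrite subr_eq0 => /eqP ->.
  by [].
have qN i j : dot (q i - q j) N = 0.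
  have [+ _] := h i; have [+ _] := h j.
  by rewrite !dotBl => /eqP; rewrite subr_eq0 => /eqP ->.
have q0N' i : dot (q i - q0) N' = 0.
  have := hN' (lift ord0 i); have := hN' ord0; rewrite extendS extend0.
  by rewrite !dotBl => /eqP; rewrite subr_eq0 => /eqP ->.
pose i1 := Ordinal (ltnW hn); pose i2 := Ordinal hn; pose i3 := Ordinal n3.
have npar a : N' <> a *: N.
  move=> e; have := q0N' i1; rewrite e dotZr qo opprD addrA dotBl dotZl.
  rewrite (h i1).1 sub0r => /eqP; rewrite mulf_eq0 oppr_eq0 mulf_eq0.
  rewrite (negbTE t0) (negbTE NN) !orbF => /eqP a0.
  by move: N'0; rewrite e a0 scale0r eqxx.
have inj := inj_eq hq.1.2.
have q12 : q i2 - q i1 != 0 by rewrite subr_eq0 inj.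
have := common_orthogonal_parallel N0 npar q12 (qN _ _) (qN' _ _)
  (qN i3 i1) (qN' i3 i1).
(* Translation by [o] puts the circle on a sphere about the origin. *)
have shift i : q i - q i1 = (q i - o) - (q i1 - o).
  by rewrite opprB addrA subrK.
rewrite !shift; apply: sphere_not_collinear.
- by rewrite -!sqr_enorm (h i1).2 (h i2).2.
- by rewrite -!sqr_enorm (h i1).2 (h i3).2.
- by rewrite (inj_eq (addIr _)) inj.
- by rewrite (inj_eq (addIr _)) inj.
- by rewrite (inj_eq (addIr _)) inj.
Qed.

End Extension.

Theorem theorem4 (R : realType) (n : nat) (hn : (1 < n)%N)
    (m : 'I_n -> R) (q : 'I_n -> 'rV[R]_3) (m0 : R) (q0 : 'rV[R]_3)
    (hq : central_configuration m q)
    (hext : configuration (extend m0 m) (extend q0 q))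
    (hcol : ~ collinear (extend q0 q)) :
  (central_configuration (extend m0 m) (extend q0 q) <->
     wayI m q q0 \/ wayII m q q0 \/ wayIII m q q0 hn \/
     wayIV m q q0 \/ wayV m q q0) /\
  [/\ wayI m q q0 -> planar (extend q0 q),
      wayII m q q0 -> planar (extend q0 q),
      wayIII m q q0 hn -> pyramidal (extend m0 m) (extend q0 q),
      wayIV m q q0 -> spatial (extend q0 q) &
      wayV m q q0 -> spatial (extend q0 q)].
Proof.
have central_of_way w := equidistant_central_extend hn hq hext
  (equidistant_of_way (hn := hn) w).
split; [split=> [h|//] | split].
- apply: (way_of_equidistant _ hq hext).
  exact: (central_extend_equidistant hn hq hext hcol h).
- by move=> [o [N [r [circ _ qo]]]]; exact: planar_extend_center circ qo.
- by move=> [o [N [r [circ _ _ qo]]]]; exact: planar_extend_center circ qo.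
- move=> w3; split.
  + by apply: central_of_way; right; right; left.
  + exact: wayIII_spatial w3.
  + have [_ [o [N [r [[N0 _ h] _ _ _]]]]] := w3.
    (* Dropping the added body leaves [q], which lies in the plane of the circle. *)
    by exists ord0, o, N; split=> // i; rewrite extendS; case: (h i).
- by move=> [o [r [[sq _ _] _ _]]] /planar_extendS.
- by move=> [o [r [[sq _ _] _ _ _]]] /planar_extendS.
Qed.
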